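(* Let $h(x)$ be a polynomial with real coefficients, let $A$ be an arbitrary $(m+1)$-dimensional unitary algebra over $K$ ($K=\mathbb{R}$ or $\mathbb{C}$) with basis $\{e_0,e_1,\dots,e_m\}$, and let $Q_{h,n}(x)=\sum_{k=0}^{m}F_{h,n+k}(x)\,e_k$ ($n\ge 0$) be the $h(x)$-Fibonacci polynomials in $A$. Then for any natural numbers $n$ and $p$ the following relations hold: (i) $Q_{h,n+2}(x)=h(x)\,Q_{h,n+1}(x)+Q_{h,n}(x)$; (ii) $\displaystyle \sum_{k=1}^{p}Q_{h,k}(x)=\frac{1}{h(x)}\bigl(Q_{h,p+1}(x)+Q_{h,p}(x)-Q_{h,0}(x)-Q_{h,1}(x)\bigr)$, where $h(x)\neq 0$.
   Context: The real $h(x)$-Fibonacci polynomials $F_{h,n}(x)$ are defined by $F_{h,0}(x)=0$, $F_{h,1}(x)=1$ and $F_{h,n}(x)=h(x)F_{h,n-1}(x)+F_{h,n-2}(x)$ for $n\ge 2$. The variable $x$ is real, and the identities are understood for the values $Q_{h,n}(x)\in A$. The algebra $A$ has a unit and a $K$-bilinear product; it is not assumed associative or commutative. *)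

(* Defs.v *)
From HB Require Import structures.
From mathcomp Require Import all_boot all_order all_algebra.
From mathcomp Require Import reals complex.

Set Implicit Arguments.
Unset Strict Implicit.
Unset Printing Implicit Defensive.

Import GRing.Theory.
Local Open Scope ring_scope.

Variant ground := RealGround | ComplexGround.

Definition ground_field (R : realType) (g : ground) : fieldType :=
  match g with
  | RealGround => R
  | ComplexGround => R[i]
  end.

Definition of_real (R : realType) (g : ground) :
    {rmorphism R -> ground_field R g} :=
  match g return {rmorphism R -> ground_field R g} with
  | RealGround => idfun
  | ComplexGround => real_complex R
  end.

(* MathComp's algType and falgType cannot be used here: their product is
   associative. *)
HB.mixin Record Vector_isUnitaryAlgebra (K : fieldType) A of Vector K A := {
  uaMul : {bilinear A -> A -> A};
  uaOne : A;
  uaMul1l : left_id uaOne uaMul;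
  uaMul1r : right_id uaOne uaMul
}.

#[short(type="unitaryAlgType")]
HB.structure Definition UnitaryAlgebra (K : fieldType) :=
  { A of Vector K A & Vector_isUnitaryAlgebra K A }.

Fixpoint hfib (R : realType) (h : {poly R}) (n : nat) : {poly R} :=
  match n with
  | 0 => 0
  | n1.+1 =>
      match n1 with
      | 0 => 1
      | n2.+1 => h * hfib h n1 + hfib h n2
      end
  end.

Definition Qhfib (R : realType) (g : ground) (h : {poly R}) (m : nat)
    (A : unitaryAlgType (ground_field R g)) (e : m.+1.-tuple A)
    (n : nat) (x : R) : A :=
  \sum_(k < m.+1) of_real R g (hfib h (n + k)).[x] *: tnth e k.

(* Main.v *)
Require Import Defs.
From mathcomp Require Import all_boot all_order all_algebra.
From mathcomp Require Import reals complex.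

Set Implicit Arguments.
Unset Strict Implicit.
Unset Printing Implicit Defensive.

Import GRing.Theory.
Local Open Scope ring_scope.

(** The Fibonacci recurrence is invariant under the index shift by k, so it holds for each
    coordinate and hence for Q ([Qhfib_rec]). Summing it telescopes with step two, leaving two terms
    at each end ([scale_sum_Qhfib]); dividing by h(x) gives the sum formula. *)

Lemma Qhfib_rec (R : realType) (g : ground) (h : {poly R}) (m : nat)
    (A : unitaryAlgType (ground_field R g)) (e : m.+1.-tuple A)
    (n : nat) (x : R) :
  Qhfib h e n.+2 x = of_real R g h.[x] *: Qhfib h e n.+1 x + Qhfib h e n x.
Proof.
rewrite /Qhfib scaler_sumr -big_split; apply: eq_bigr => k _.
(* Evaluation at x and [of_real] both preserve sums and products. *)
by rewrite !addSn [hfib h _.+2]/= hornerD hornerM rmorphD rmorphM scalerDl scalerA.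
Qed.

(* The recurrence makes each h(x) Q_k = Q_{k+1} - Q_{k-1}, so the sum telescopes. *)
Lemma scale_sum_Qhfib (R : realType) (g : ground) (h : {poly R}) (m : nat)
    (A : unitaryAlgType (ground_field R g)) (e : m.+1.-tuple A)
    (p : nat) (x : R) :
  of_real R g h.[x] *: (\sum_(1 <= k < p.+1) Qhfib h e k x) =
    Qhfib h e p.+1 x + Qhfib h e p x - Qhfib h e 0 x - Qhfib h e 1 x.
Proof.
elim: p => [|p IHp]; first by rewrite big_geq // scaler0 addrK subrr.
rewrite big_nat_recr //= scalerDr IHp Qhfib_rec.
by rewrite addrC !addrA [in RHS](addrAC _ _ (Qhfib h e p.+1 x)).
Qed.

Theorem proposition3p2 (R : realType) (g : ground) (h : {poly R}) (m : nat)
    (A : unitaryAlgType (ground_field R g)) (hA : \dim {:A} = m.+1)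
    (e : m.+1.-tuple A) (he : basis_of {:A} e) (n p : nat) (x : R) :
  Qhfib h e n.+2 x = of_real R g h.[x] *: Qhfib h e n.+1 x + Qhfib h e n x
  /\
  (h.[x] != 0 ->
   \sum_(1 <= k < p.+1) Qhfib h e k x =
     of_real R g (1 / h.[x]) *:
       (Qhfib h e p.+1 x + Qhfib h e p x - Qhfib h e 0 x - Qhfib h e 1 x)).
Proof.
split=> [|hx0]; first exact: Qhfib_rec.
(* The inverse of h(x) is taken in [R] and cancels there, under [of_real]. *)
by rewrite -scale_sum_Qhfib scalerA -rmorphM div1r mulVf // rmorph1 scale1r.
Qed.
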